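(* Let $f:\mathbb{R}^n\times\mathbb{R}^m\times\mathbb{N}\to\mathbb{R}^n$ be smooth and suppose that for every $t\ge 0$ there is $L_t>0$ with $\|f(x,d,t)-f(y,d,t)\|\le L_t\|x-y\|$ for all $x,y\in\mathbb{R}^n$, $d\in\mathbb{R}^m$. Let $(w_t)_{t\ge0}$ be independent random vectors in $\mathbb{R}^n$ with $w_t\sim subG(\sigma_t^2)$ for some finite $\sigma_t>0$. Consider the stochastic system $X_{t+1}=f(X_t,d_t,t)+w_t$ and the deterministic system $x_{t+1}=f(x_t,d_t,t)$, and let $X_t$ and $x_t$ be trajectories of these systems with the same initial state $X_0=x_0\in\mathcal{X}_0$ and the same inputs $d_t\in\mathcal{D}$ for $t\le T$, where $T\in\mathbb{N}_+$. For $\delta\in(0,1]$ and $\varepsilon\in(0,1)$ define $$r_{\delta,t}=\sqrt{\Psi_t\big(\varepsilon_1 n+\varepsilon_2\log(T/\delta)\big)},\quad \Psi_t=\psi_{t-1}\sum_{k=0}^{t-1}\sigma_k^2\psi_k^{-1},\quad \psi_t=\prod_{k=0}^{t}L_k^2,$$ $$\varepsilon_1=\frac{2\log(1+2/\varepsilon)}{(1-\varepsilon)^2},\qquad \varepsilon_2=\frac{2}{(1-\varepsilon)^2}$$ (with $\psi_{-1}=1$ and empty sums equal to $0$). Then $$\mathbb{P}\big(\|X_t-x_t\|\le r_{\delta,t}\ \text{for all } t\le T\big)\ge 1-\delta.$$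
   Context: $\|\cdot\|$ is the Euclidean norm and $\langle\cdot,\cdot\rangle$ the standard inner product. A random vector $X\in\mathbb{R}^n$ is sub-Gaussian with variance proxy $\sigma^2$, written $X\sim subG(\sigma^2)$, if $\mathbb{E}(X)=0$ and for every unit vector $\ell\in\mathcal{S}^{n-1}$ and every $\lambda\in\mathbb{R}$, $\mathbb{E}\big(e^{\lambda\langle \ell,X\rangle}\big)\le e^{\lambda^2\sigma^2/2}$. $\mathcal{X}_0\subseteq\mathbb{R}^n$ and $\mathcal{D}\subseteq\mathbb{R}^m$ are arbitrary sets of initial states and inputs. *)

(* Defs.v *)
From HB Require Import structures.
From mathcomp Require Import all_boot all_order all_algebra.
From mathcomp Require Import all_classical all_reals all_analysis.
Set Implicit Arguments. Unset Strict Implicit. Unset Printing Implicit Defensive.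
Import Order.TTheory GRing.Theory Num.Theory.
Import numFieldNormedType.Exports.
Local Open Scope classical_set_scope.
Local Open Scope ring_scope.

(* Euclidean inner product and norm on row vectors R^n = 'rV[R]_n
   (the library norm on matrices is the max-norm, so we define these). *)
Definition edot (R : realType) (n : nat) (u v : 'rV[R]_n) : R :=
  \sum_(i < n) u 0 i * v 0 i.
Definition enorm (R : realType) (n : nat) (u : 'rV[R]_n) : R :=
  Num.sqrt (edot u u).

Fixpoint iter_dderiv (R : realType) (V W : normedModType R) (s : seq V)
    (g : V -> W) : V -> W :=
  match s with
  | [::] => g
  | v :: s' => 'D_v (iter_dderiv s' g)
  end.

Definition smooth (R : realType) (V W : normedModType R) (g : V -> W) : Prop :=
  forall (s : seq V), continuous (iter_dderiv s g) /\
    forall (v x : V), derivable (iter_dderiv s g) x v.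

Section Prob.
Context (d : measure_display) (T : measurableType d) (R : realType).
Context (P : probability T R).

Definition rvec n := 'I_n -> T -> R.

Definition vec_of n (X : rvec n) (w : T) : 'rV[R]_n := \row_i X i w.

Definition rvec_measurable n (X : rvec n) : Prop :=
  forall i, measurable_fun setT (X i).

(* sigma-algebra generated by a random vector (Borel sets of R^n are generated
   by products of Borel sets of R, so by coordinate preimages). *)
Definition sigma_rvec n (X : rvec n) : set (set T) :=
  <<s [set A | exists i (B : set R), measurable B /\ A = X i @^-1` B] >>.

Definition mutually_independent n (w : nat -> rvec n) : Prop :=
  forall (s : seq nat) (A : nat -> set T), uniq s ->
    (forall t, t \in s -> sigma_rvec (w t) (A t)) ->
    P (\bigcap_(t in [set t | t \in s]) A t) = (\prod_(t <- s) P (A t))%E.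

Definition subG n (X : rvec n) (sigma2 : R) : Prop :=
  (forall i, P.-integrable setT (fun w => (X i w)%:E) /\
             (\int[P]_w (X i w)%:E = 0)%E) /\
  forall (l : 'rV[R]_n) (lam : R), enorm l = 1 ->
    (\int[P]_w (expR (lam * edot l (vec_of X w)))%:E
      <= (expR (lam ^+ 2 * sigma2 / 2))%:E)%E.
End Prob.

Fixpoint det_traj (R : realType) (n m : nat)
    (f : 'rV[R]_n -> 'rV[R]_m -> nat -> 'rV[R]_n)
    (x0 : 'rV[R]_n) (dd : nat -> 'rV[R]_m) (t : nat) : 'rV[R]_n :=
  match t with
  | 0 => x0
  | t'.+1 => f (det_traj f x0 dd t') (dd t') t'
  end.

Fixpoint stoch_traj (R : realType) (n m : nat)
    (f : 'rV[R]_n -> 'rV[R]_m -> nat -> 'rV[R]_n)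
    (x0 : 'rV[R]_n) (dd : nat -> 'rV[R]_m) (wv : nat -> 'rV[R]_n)
    (t : nat) : 'rV[R]_n :=
  match t with
  | 0 => x0
  | t'.+1 => f (stoch_traj f x0 dd wv t') (dd t') t' + wv t'
  end.

(* psi_shift L k = psi_{k-1} = prod_{j=0}^{k-1} L_j^2 (so psi_shift L 0 = psi_{-1} = 1). *)
Definition psi_shift (R : realType) (L : nat -> R) (k : nat) : R :=
  \prod_(j < k) (L j) ^+ 2.

Definition Psi (R : realType) (L sigma : nat -> R) (t : nat) : R :=
  psi_shift L t * \sum_(k < t) (sigma k) ^+ 2 / psi_shift L k.+1.

Definition eps1 (R : realType) (eps : R) : R :=
  2 * ln (1 + 2 / eps) / (1 - eps) ^+ 2.
Definition eps2 (R : realType) (eps : R) : R := 2 / (1 - eps) ^+ 2.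

Definition r_delta (R : realType) (n : nat) (L sigma : nat -> R)
    (eps delta : R) (T : nat) (t : nat) : R :=
  Num.sqrt (Psi L sigma t * (eps1 eps * n%:R + eps2 eps * ln (T%:R / delta))).

(* Main.v *)
(* With [e_t = X_t - x_t], [e_(t+1) = g_t + w_t] where [|g_t| <= L_t |e_t|] and
   [g_t] depends only on [w_0, ..., w_(t-1)].  The Gaussian integral
   [exp(|x|^2 / 2s) = (s / 2pi)^(n/2) int exp(<z, x> - s |z|^2 / 2) dz] linearises
   the square, so that independence and the sub-Gaussian bound apply under the
   integral and give
   [E exp(|g + w|^2 / 2s) <= (s / (s - sigma^2))^(n/2) E exp(|g|^2 / 2(s - sigma^2))].
   Iterating along the recursion [Psi_(t+1) = L_t^2 Psi_t + sigma_t^2] yields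
   [E exp(|e_t|^2 / 2s) <= (s / (s - Psi_t))^(n/2)] for all [s > Psi_t].  Markov's
   inequality at [s = Psi_t / (1 - eps)^2] bounds each deviation probability by
   [delta / T], because [(1 - (1 - eps)^2)^(-1/2) <= 1 + 2 / eps]; a union bound
   over [1 <= t <= T] concludes. *)
Require Import Defs.
From HB Require Import structures.
From mathcomp Require Import all_boot all_order all_algebra.
From mathcomp Require Import all_classical all_reals all_analysis.
From mathcomp Require Import measurable_realfun ring lra.
Import Order.TTheory GRing.Theory Num.Theory.
Import numFieldNormedType.Exports.
Local Open Scope classical_set_scope.
Local Open Scope ring_scope.

Set Implicit Arguments.
Unset Strict Implicit.

(** * Gaussian integrals over R^n *)

Lemma sigma_finite_product {R : realType} d1 d2 (T1 : measurableType d1)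
    (T2 : measurableType d2) (m1 : {sigma_finite_measure set T1 -> \bar R})
    (m2 : {sigma_finite_measure set T2 -> \bar R}) :
  sigma_finite setT (m1 \x m2)%E.
Proof.
have /sigma_finiteP[F [TF ndF Foo]] := sigma_finiteT m1.
have /sigma_finiteP[G [TG ndG Goo]] := sigma_finiteT m2.
exists (fun n => F n `*` G n) => [|k].
  apply/esym; rewrite -subTset => -[x y] _.
  have [i _ Fix] : (\bigcup_i F i) x by rewrite -TF.
  have [j _ Gjy] : (\bigcup_i G i) y by rewrite -TG.
  (* Both exhausting sequences are nondecreasing, so the larger index serves the two coordinates at
     once. *)
  exists (maxn i j) => //; split=> /=.
    by move: x Fix; apply/subsetPset/ndF/leq_maxl.
  by move: y Gjy; apply/subsetPset/ndG/leq_maxr.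
have [mF Fk] := Foo k; have [mG Gk] := Goo k.
split; first exact: measurableX.
by rewrite product_measure1E // lte_mul_pinfty // ge0_fin_numE.
Qed.

Section gauss.
Context (R : realType).

Lemma edotDr n (u v v' : 'rV[R]_n) : edot u (v + v') = edot u v + edot u v'.
Proof. by rewrite -big_split; apply: eq_bigr => i _; rewrite /= mxE mulrDr. Qed.

Lemma edotC n (u v : 'rV[R]_n) : edot u v = edot v u.
Proof. by apply: eq_bigr => i _; rewrite mulrC. Qed.

Lemma edotZl n (a : R) (u v : 'rV[R]_n) : edot (a *: u) v = a * edot u v.
Proof. by rewrite mulr_sumr; apply: eq_bigr => i _; rewrite mxE mulrA. Qed.

Lemma edot0l n (v : 'rV[R]_n) : edot 0 v = 0.
Proof. by apply: big1 => i _; rewrite mxE mul0r. Qed.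

Lemma edot_ge0 n (u : 'rV[R]_n) : 0 <= edot u u.
Proof. by apply: sumr_ge0 => i _; rewrite -expr2 sqr_ge0. Qed.

Lemma edot_eq0 n (u : 'rV[R]_n) : edot u u = 0 -> u = 0.
Proof.
move=> /psumr_eq0P h; apply/rowP => i; rewrite mxE; apply/eqP.
by rewrite -sqrf_eq0 expr2; apply/eqP/h => // j _; rewrite -expr2 sqr_ge0.
Qed.

Lemma enorm_sqr n (u : 'rV[R]_n) : enorm u ^+ 2 = edot u u.
Proof. by rewrite sqr_sqrtr // edot_ge0. Qed.

(** Completing the square gives [x v - b x^2 / 2 = v^2 / (2b) - (b / 2) (x - v / b)^2], so the
    integrand is a constant multiple of the normal density with mean [v / b] and variance
    [1 / b]. *)
Lemma integral_gauss1 (b v : R) : 0 < b ->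
  (\int[lebesgue_measure]_x (expR (x * v - b / 2 * x ^+ 2))%:E
    = (Num.sqrt (2 * pi / b) * expR (v ^+ 2 / (2 * b)))%:E)%E.
Proof.
move=> b0; pose s := Num.sqrt b^-1.
have s0 : s != 0 by rewrite gt_eqF // sqrtr_gt0 invr_gt0.
have s2 : s ^+ 2 = b^-1 by rewrite sqr_sqrtr // invr_ge0 ltW.
pose c := expR (v ^+ 2 / (2 * b)) / normal_peak s.
have p0 := normal_peak_gt0 s0.
transitivity (\int[lebesgue_measure]_x (c%:E * (normal_pdf (v / b) s x)%:E))%E.
  apply: eq_integral => x _; rewrite -EFinM; congr (_%:E).
  have -> : normal_pdf (v / b) s x = normal_peak s * normal_fun (v / b) s x.
    by rewrite normal_pdfE.
  rewrite [RHS]mulrA mulfVK ?gt_eqF // /normal_fun -expRD s2.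
  by congr expR; field; rewrite gt_eqF.
rewrite ge0_integralZl //.
- rewrite integral_normal_pdf mule1 /c /normal_peak invrK mulrC s2.
  by congr ((Num.sqrt _ * _)%:E); ring.
- by apply/measurable_EFinP; exact: measurable_normal_pdf.
- by move=> x _; rewrite lee_fin normal_pdf_ge0.
- by rewrite lee_fin /c divr_ge0 ?expR_ge0 ?ltW.
Qed.

Lemma measurable_edot d (T : measurableType d) n (Y Z : T -> 'rV[R]_n) :
  (forall i, measurable_fun setT (fun x => Y x 0 i)) ->
  (forall i, measurable_fun setT (fun x => Z x 0 i)) ->
  measurable_fun setT (fun x => edot (Y x) (Z x)).
Proof.
by move=> mY mZ; apply: measurable_sum => i; exact: measurable_funM.
Qed.

(* The existential packages Lebesgue measure on R^n, obtained by iterating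
   binary products; [Z] plays the role of the identity map of R^n. *)
Lemma gauss_measure n :
  exists (d : measure_display) (T : measurableType d)
    (mu : {sigma_finite_measure set T -> \bar R}) (Z : T -> 'rV[R]_n),
    (forall i, measurable_fun setT (fun x => Z x 0 i)) /\
    forall (b : R) (v : 'rV[R]_n), 0 < b ->
      (\int[mu]_x (expR (edot (Z x) v - b / 2 * edot (Z x) (Z x)))%:E
       = (Num.sqrt (2 * pi / b) ^+ n * expR (edot v v / (2 * b)))%:E)%E.
Proof.
elim: n => [|n [d [T [mu [Z [mZ IH]]]]]].
  (* R^0 is a single point of mass 1, modelled by a Dirac mass; both sides equal 1. *)
  exists _, (measurableTypeR R), (@dirac _ (measurableTypeR R) (0 : R) R), (fun=> 0).
  split=> [[]//|b v b0].
  rewrite (eq_integral (cst 1%E)) ?integral_cst //= ?mul1e; last first.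
    by move=> x _; rewrite /edot !big_ord0 mulr0 subr0 expR0.
  by rewrite /edot big_ord0 mul0r expR0 expr0 mulr1 diracT.
pose Z' (p : measurableTypeR R * T) : 'rV[R]_n.+1 :=
  \row_i (if unlift ord0 i is Some j then Z p.2 0 j else p.1).
have Z'E p v : edot (Z' p) v =
    p.1 * v 0 ord0 + edot (Z p.2) (\row_j v 0 (lift ord0 j)).
  rewrite /edot big_ord_recl mxE unlift_none; congr (_ + _).
  by apply: eq_bigr => i _; rewrite !mxE liftK.
have Z'Z' p : edot (Z' p) (Z' p) = p.1 ^+ 2 + edot (Z p.2) (Z p.2).
  rewrite Z'E mxE unlift_none -expr2; congr (_ + edot _ _).
  by apply/rowP => i; rewrite !mxE liftK.
have mZ' i : measurable_fun setT (fun x => Z' x 0 i).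
  under eq_fun do rewrite mxE.
  case: unliftP => [j _|_]; last exact: measurable_fst.
  exact: (measurableT_comp (mZ j) measurable_snd).
pose leb : {sigma_finite_measure set (measurableTypeR R) -> \bar R} :=
  @lebesgue_measure R.
(* Packed by hand: unification only finds the instance for products of
   subprobabilities. *)
pose sf := Measure_isSigmaFinite.Build _ _ _ (leb \x mu)%E
  (sigma_finite_product leb mu).
pose mu' : {sigma_finite_measure set (measurableTypeR R * T)%type -> \bar R} :=
  HB.pack (leb \x mu)%E sf.
exists _, (measurableTypeR R * T)%type, mu', Z'; split=> // b v b0.
rewrite (fubini_tonelli1 (m1 := leb) (m2 := mu)); last 2 first.
- apply/measurable_EFinP/measurableT_comp => //; apply: measurable_funB.
    by apply: measurable_edot.
  by apply: measurable_funM => //; exact: measurable_edot.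
- by move=> p; rewrite lee_fin expR_ge0.
pose v' := \row_j v 0 (lift ord0 j) : 'rV[R]_n.
pose C := Num.sqrt (2 * pi / b) ^+ n * expR (edot v' v' / (2 * b)).
(* For fixed first coordinate, the inner integral over the other [n] is [C] by induction, times a
   one-dimensional Gaussian factor. *)
transitivity (\int[lebesgue_measure]_x
    (C%:E * (expR (x * v 0 ord0 - b / 2 * x ^+ 2))%:E))%E.
  apply: eq_integral => x _ /=; rewrite /fubini_F -(IH b v') //.
  rewrite muleC -ge0_integralZl //.
  - apply: eq_integral => y _; rewrite -EFinM -expRD Z'E Z'Z' /=.
    by congr ((expR _)%:E); rewrite -/v'; ring.
  - apply/measurable_EFinP/measurableT_comp => //; apply: measurable_funB.
      by apply: measurable_edot.
    by apply: measurable_funM => //; exact: measurable_edot.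
rewrite ge0_integralZl //.
- rewrite integral_gauss1 // -EFinM /C.
  rewrite [edot v v]big_ord_recl.
  have -> : \sum_(i < n) v 0 (lift ord0 i) * v 0 (lift ord0 i) = edot v' v'.
    by apply: eq_bigr => i _; rewrite !mxE.
  rewrite (mulrDl (v 0 ord0 * v 0 ord0)) expRD -expr2.
  by rewrite mulrC mulrACA -(exprS _ n).
- apply/measurable_EFinP/measurableT_comp => //; apply: measurable_funB.
    exact: measurable_funM.
  by apply: measurable_funM => //; exact: measurable_funX.
- by rewrite lee_fin /C mulr_ge0 ?expR_ge0 ?exprn_ge0 ?sqrtr_ge0.
Qed.
End gauss.

(** * Continuous functions of finitely many measurable coordinates *)

(** Countably many balls, with rational centres and radii [1 / (k + 1)], suffice to cover an open
    set from inside. Taking the radius below [e / 2] keeps the ball within distance [e] of [x]. *)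
Lemma ball_rat_subset {R : realType} n (O : set 'rV[R]_n) (x : 'rV[R]_n) :
  nbhs x O -> exists (q : {ffun 'I_n -> rat}) (k : nat),
    ball (\row_i ratr (q i) : 'rV[R]_n) k.+1%:R^-1 `<=` O /\
    forall i, `|x 0 i - ratr (q i)| < k.+1%:R^-1.
Proof.
move=> /nbhs_ballP[e /= e0 xeO].
have e20 : 0 < e / 2 by rewrite divr_gt0.
have [k ke] : exists k : nat, k.+1%:R^-1 < e / 2.
  by exists (Num.truncn (e / 2)^-1); rewrite invf_plt ?posrE // truncnS_gt.
have k0 : 0 < k.+1%:R^-1 :> R by rewrite invr_gt0.
set r := k.+1%:R^-1 in ke k0.
have /choice[q xq] : forall i, exists q : rat, `|x 0 i - ratr q| < r.
  move=> i; have /rat_in_itvoo[q] :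
      x 0 i - r < x 0 i + r :> R by lra.
  by rewrite in_itv /= => /andP[? ?]; exists q; rewrite ltr_norml; lra.
exists (finfun q), k; split=> [y [_ qy]|i]; last by rewrite ffunE.
apply: xeO; split=> // a i; rewrite (ord1 a).
have := qy 0 i; rewrite mxE ffunE => {}qy.
have {}qy : `|ratr (q i) - y 0 i| < r := qy.
change (`|x 0 i - y 0 i| < e); have := xq i.
move: qy; rewrite !ltr_norml => /andP[? ?] /andP[? ?]; lra.
Qed.

(** The preimage of an open set is the union, over the rational balls it contains, of finite
    intersections of coordinate conditions. The sigma-algebra on [T] is arbitrary, so the result
    also applies to the one generated by past noises. *)
Lemma measurable_continuous_row {R : realType} d (T : measurableType d) n
    (h : 'rV[R]_n -> R) (X : 'I_n -> T -> R) :
  continuous h -> (forall i, measurable_fun setT (X i)) ->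
  measurable_fun setT (fun x => h (\row_i X i x)).
Proof.
move=> ch mX _; apply: (measurability _ (RGenOInfty.measurableE R)) => //.
move=> /= _ [_ [a ->] <-]; rewrite preimage_itvoy setTI.
pose O := [set u | a < h u].
have oO : open O by apply: (proj1 (continuousP _) ch [set r | a < r]); exact: open_gt.
pose B (p : {ffun 'I_n -> rat} * nat) :=
  ball (\row_i ratr (p.1 i) : 'rV[R]_n) p.2.+1%:R^-1.
pose F p := if `[< B p `<=` O >] then \bigcap_(i in [set: 'I_n])
  [set x | `|X i x - ratr (p.1 i)| < p.2.+1%:R^-1] else set0.
rewrite [X in measurable X](_ : _ = \bigcup_p F p).
  apply: countable_bigcupT_measurable => // p; rewrite /F; case: ifP => // _.
  apply: fin_bigcap_measurable => // i _; rewrite -[X in measurable X]setTI.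
  have -> : [set x | `|X i x - ratr (p.1 i)| < p.2.+1%:R^-1] =
      (fun x => `|X i x - ratr (p.1 i)|) @^-1` [set` `]-oo, p.2.+1%:R^-1[].
    by apply/seteqP; split => x /=; rewrite in_itv.
  apply: measurableT_comp => //; exact: measurable_funB.
apply/seteqP; split=> [x Ox|x [p _]].
  have /ball_rat_subset[q [k [qkO xq]]] : nbhs (\row_i X i x) O.
    exact: open_nbhs_nbhs.
  exists (q, k) => //; rewrite /F asboolT // => i _ /=.
  by have := xq i; rewrite mxE.
rewrite /F; case: ifPn => // /asboolP pO xp; apply: pO; split=> [|a' i].
  by rewrite invr_gt0.
by rewrite (ord1 a') !mxE /ball /= distrC; exact: xp.
Qed.

(** * Independence of the past from the current noise *)

Section independence.
Context d (T : measurableType d) (R : realType) (P : probability T R).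

(** The joint law of [(U, V)] agrees with the product of the marginal laws on rectangles, hence
    everywhere; Tonelli then splits the integral. *)
Lemma ge0_integral_indep (U V : T -> R) :
  measurable_fun setT U -> measurable_fun setT V ->
  (forall x, 0 <= U x) -> (forall x, 0 <= V x) ->
  (forall A B, measurable A -> measurable B ->
    P (U @^-1` A `&` V @^-1` B) = P (U @^-1` A) * P (V @^-1` B))%E ->
  (\int[P]_x (U x * V x)%:E = \int[P]_x (U x)%:E * \int[P]_x (V x)%:E)%E.
Proof.
move=> mU mV U0 V0 UV.
pose U' : {mfun T >-> R} := HB.pack U (isMeasurableFun.Build _ _ _ _ U mU).
pose V' : {mfun T >-> R} := HB.pack V (isMeasurableFun.Build _ _ _ _ V mV).
pose W x := (U x, V x).
have mW : measurable_fun setT W by exact: measurable_fun_pair.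
pose W' : {mfun T >-> (R * R)%type} := HB.pack W (isMeasurableFun.Build _ _ _ _ W mW).
(* Absolute values make [f] nonnegative on the whole plane; they disappear on the range of
   [(U, V)]. *)
pose f (p : R * R) : \bar R := (`|p.1| * `|p.2|)%:E.
have mf : measurable_fun setT f.
  by apply/measurable_EFinP; apply: measurable_funM; exact: measurableT_comp.
have f0 p : (0 <= f p)%E by rewrite lee_fin mulr_ge0.
have nU x : `|U x| = U x by rewrite ger0_norm.
have nV x : `|V x| = V x by rewrite ger0_norm.
transitivity (\int[distribution P W']_p f p)%E.
  rewrite ge0_integral_distribution //; apply: eq_integral => x _.
  by rewrite /f /= nU nV.
transitivity (\int[distribution P U' \x distribution P V']_p f p)%E.
  apply: eq_measure_integral => A mA _; apply/esym; apply: product_measure_unique => //.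
rewrite fubini_tonelli1 //.
pose IV : \bar R := (\int[P]_x (V x)%:E)%E.
have IVE : (\int[distribution P V']_y (`|y|)%:E = IV)%E.
  rewrite ge0_integral_distribution //; last first.
    by apply/measurable_EFinP; exact: normr_measurable.
  by apply: eq_integral => x _; rewrite /= nV.
transitivity (\int[distribution P U']_x ((`|x|)%:E * IV))%E.
  apply: eq_integral => x _; rewrite -IVE -ge0_integralZl //.
  by apply/measurable_EFinP; exact: normr_measurable.
rewrite ge0_integral_distribution; last 2 first.
- apply: emeasurable_funM => //; apply/measurable_EFinP; exact: normr_measurable.
- move=> x; rewrite mule_ge0 // integral_ge0 // => y _; by rewrite lee_fin.
rewrite -ge0_integralZr //.
- by apply: eq_integral => x _; rewrite /= nU.
- exact/measurable_EFinP.
- by move=> x _; rewrite lee_fin.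
- by apply: integral_ge0 => y _; rewrite lee_fin.
Qed.

Definition past_events n (w : nat -> rvec T R n) (t : nat) : set (set T) :=
  [set A | exists s i (B : set R),
    [/\ (s < t)%N, measurable B & A = w s i @^-1` B]].

Lemma sigma_rvec_measurable n (X : rvec T R n) :
  rvec_measurable X -> sigma_rvec X `<=` measurable.
Proof.
move=> mX; apply: smallest_sub; first exact: sigma_algebra_measurable.
by move=> _ [i [B [mB ->]]]; rewrite -[X in measurable X]setTI; exact: mX.
Qed.

(** A pi-system argument: [X |-> P (X & B)] and [P B] times [P] are finite measures that agree on
    [G], the finite intersections of events of single past noises. [G] is stable under intersection
    and its sigma-algebra contains the past. *)
Lemma past_events_indep n (w : nat -> rvec T R n) t A B :
  (forall s, rvec_measurable (w s)) -> mutually_independent P w ->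
  <<s past_events w t >> A -> sigma_rvec (w t) B ->
  P (A `&` B) = (P A * P B)%E.
Proof.
move=> mw iw sA sB; have mB := sigma_rvec_measurable (mw t) sB.
pose G : set (set T) := [set A | exists2 F : nat -> set T,
  (forall s, (s < t)%N -> sigma_rvec (w s) (F s)) &
  A = \bigcap_(s in [set s | s \in iota 0 t]) F s].
have sT (X : rvec T R n) : sigma_rvec X setT.
  exact: (@measurableT _ (g_sigma_algebraType _)).
have pastG : past_events w t `<=` G.
  move=> _ [s [i [C [st mC ->]]]].
  (* A generator constrains one index; the other indices get the full space. *)
  exists (fun r => if r == s then w s i @^-1` C else setT) => [r rt|].
    by case: eqP => // ->; apply: sub_sigma_algebra; exists i, C.
  apply/seteqP; split=> [x wx r _|x /(_ s)]; first by case: ifP.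
  by rewrite eqxx; apply; rewrite /= mem_iota.
have mG : G `<=` measurable.
  move=> _ [F sF ->]; apply: bigcap_measurableType => s /=.
  by rewrite mem_iota => /sF; apply: sigma_rvec_measurable.
have := @g_sigma_algebra_measure_unique _ R T G mG (fun=> setT) _ _
  (mrestr P mB) (mscale (NngNum (fine_ge0 (measure_ge0 P B))) P).
have PE X : ((fine (P B))%:E * P X = P X * P B)%E.
  by rewrite fineK ?fin_num_measure // muleC.
rewrite /= /mscale /mrestr /= => h; rewrite -PE; apply: h.
- by move=> _; exists (fun=> setT) => //; apply/seteqP; split.
- by apply/seteqP; split=> // x _; exists 0%N.
- move=> _ _ [F sF ->] [F' sF' ->].
  exists (fun s => F s `&` F' s); last by rewrite bigcapI.
  move=> s st; apply: (@measurableI _ (g_sigma_algebraType _)).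
    exact: sF.
  exact: sF'.
- move=> _ [F sF ->]; rewrite PE iw ?iota_uniq //; last first.
    by move=> s; rewrite mem_iota => /sF.
  (* Mutual independence is used twice: on the past indices alone, and on those together with [t],
     where the event is [B]. *)
  pose F' s := if s == t then B else F s.
  have ne s : s \in iota 0 t -> s == t = false.
    by rewrite mem_iota => /andP[_]; rewrite add0n ltn_neqAle => /andP[/negbTE].
  have F't : F' t = B by rewrite /F' eqxx.
  have F'E s : s \in iota 0 t -> F' s = F s by rewrite /F' => /ne ->.
  have := iw (t :: iota 0 t) F'.
  rewrite big_cons F't muleC.
  rewrite (eq_big_seq (fun s => P (F s))) => [<-|s /F'E -> //].
  + congr (P _); apply/seteqP; split=> [x [xF xB] s /=|x xF].
      by rewrite inE => /predU1P[->|s_t]; rewrite ?F't // F'E //; exact: xF.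
    split=> [s /= s_t|]; last by have := xF t; rewrite /= inE eqxx F't; exact.
    by have := xF s; rewrite /= inE s_t orbT F'E //; exact.
  + by rewrite /= iota_uniq mem_iota ltnn andbF.
  + move=> s; rewrite inE => /predU1P[->|s_t]; first by rewrite F't.
    by rewrite F'E //; move: s_t; rewrite mem_iota => /sF.
- by move=> _; rewrite /mrestr; apply: le_lt_trans (probability_le1 _ _) _ => //; 
  rewrite ?ltry //; exact: measurableI.
- exact: (sub_smallest2r _ pastG).
Qed.
End independence.

(** * One noise step for the exponential of the squared norm *)

Section step.
Context d (T : measurableType d) (R : realType) (P : probability T R) (n : nat).

(** Take the unit direction [z / |z|] and [lam = |z|]; the zero vector has no direction and is
    treated apart. *)
Lemma subG_mgf (X : rvec T R n) (sigma2 : R) : subG P X sigma2 ->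
  forall z, (\int[P]_w (expR (edot z (vec_of X w)))%:E
    <= (expR (edot z z * sigma2 / 2))%:E)%E.
Proof.
move=> [_ sX] z; have [zz0|zz0] := eqVneq (edot z z) 0.
  rewrite zz0 !mul0r expR0 (edot_eq0 zz0).
  rewrite (eq_integral (cst 1%E)) => [|x _]; last by rewrite edot0l expR0.
  by rewrite integral_cst // mul1e probability_le1.
have z0 : enorm z != 0 by rewrite -sqrf_eq0 enorm_sqr.
have l1 : enorm ((enorm z)^-1 *: z) = 1.
  rewrite [LHS]/enorm edotZl edotC edotZl -enorm_sqr expr2.
  by rewrite mulKf // mulVf // sqrtr1.
have := sX _ (enorm z) l1; rewrite enorm_sqr.
by under eq_integral do rewrite edotZl mulVKf //.
Qed.

(** Factorisation is assumed only for exponentials of linear forms, the form in which [g] and [X]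
    appear under the integral in [z]. *)
Lemma subG_gauss_step (X : rvec T R n) (g : T -> 'rV[R]_n) (sigma2 s : R) :
  rvec_measurable X -> (forall i, measurable_fun setT (fun w => g w 0 i)) ->
  0 <= sigma2 < s -> subG P X sigma2 ->
  (forall z, \int[P]_w (expR (edot z (g w)) * expR (edot z (vec_of X w)))%:E =
    \int[P]_w (expR (edot z (g w)))%:E *
    \int[P]_w (expR (edot z (vec_of X w)))%:E)%E ->
  (\int[P]_w (expR (edot (g w + vec_of X w) (g w + vec_of X w) / (2 * s)))%:E <=
   (Num.sqrt (s / (s - sigma2)) ^+ n)%:E *
   \int[P]_w (expR (edot (g w) (g w) / (2 * (s - sigma2))))%:E)%E.
Proof.
move=> mX mg /andP[sig0 sig_s] subX indep.
have [d' [S [mu [Z [mZ gauss]]]]] := @gauss_measure R n.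
have s0 : 0 < s by exact: le_lt_trans sig_s.
have ss0 : 0 < s - sigma2 by rewrite subr_gt0.
pose c b := Num.sqrt (2 * pi / b) ^+ n : R.
have c0 b : 0 < b -> 0 < c b.
  by move=> b0; rewrite exprn_gt0 // sqrtr_gt0 divr_gt0 // mulr_gt0 // pi_gt0.
have mexp (Y : T -> 'rV[R]_n) : (forall i, measurable_fun setT (fun w => Y w 0 i)) ->
    forall z, measurable_fun setT (fun w => (expR (edot z (Y w)))%:E).
  move=> mY z; apply/measurable_EFinP/measurableT_comp => //.
  exact: measurable_edot.
(* Linearisation of the square: expand by the Gaussian integral, then exchange expectation and
   [z]-integral by Tonelli. *)
have swap (Y : T -> 'rV[R]_n) b : 0 < b ->
    (forall i, measurable_fun setT (fun w => Y w 0 i)) ->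
    ((c b)%:E * \int[P]_w (expR (edot (Y w) (Y w) / (2 * b)))%:E =
     \int[mu]_z ((expR (- (b / 2 * edot (Z z) (Z z))))%:E *
       \int[P]_w (expR (edot (Z z) (Y w)))%:E))%E.
  move=> b0 mY; rewrite -ge0_integralZl //; last 2 first.
  - apply/measurable_EFinP/measurableT_comp => //; apply: measurable_funM => //.
    exact: measurable_edot.
  - by rewrite lee_fin ltW // c0.
  pose h (p : T * S) : \bar R :=
    (expR (edot (Z p.2) (Y p.1) - b / 2 * edot (Z p.2) (Z p.2)))%:E.
  have mZ2 i : measurable_fun setT (fun p : T * S => Z p.2 0 i).
    exact: (measurableT_comp (mZ i) measurable_snd).
  have mY1 i : measurable_fun setT (fun p : T * S => Y p.1 0 i).
    exact: (measurableT_comp (mY i) measurable_fst).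
  have mh : measurable_fun setT h.
    apply/measurable_EFinP/measurableT_comp => //; apply: measurable_funB.
      exact: measurable_edot.
    by apply: measurable_funM => //; exact: measurable_edot.
  have h0 p : (0 <= h p)%E by rewrite lee_fin expR_ge0.
  transitivity (\int[P]_w \int[mu]_z h (w, z))%E.
    by apply: eq_integral => w _; rewrite -EFinM -gauss.
  rewrite (fubini_tonelli h) //; apply: eq_integral => z _.
  rewrite -ge0_integralZl //; last exact: mexp.
  by apply: eq_integral => w _; rewrite -EFinM -expRD addrC.
have mvX i : measurable_fun setT (fun w => vec_of X w 0 i).
  by under eq_fun do rewrite mxE; exact: mX.
have mgX i : measurable_fun setT (fun w => (g w + vec_of X w) 0 i).
  by under eq_fun do rewrite mxE; exact: measurable_funD.
have minner (Y : T -> 'rV[R]_n) b : (forall i, measurable_fun setT (fun w => Y w 0 i)) ->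
    measurable_fun setT (fun z => ((expR (- (b / 2 * edot (Z z) (Z z))))%:E *
       \int[P]_w (expR (edot (Z z) (Y w)))%:E))%E.
  move=> mY; apply: emeasurable_funM.
    apply/measurable_EFinP/measurableT_comp => //; apply: measurableT_comp => //.
    by apply: measurable_funM => //; exact: measurable_edot.
  apply: (measurable_fun_fubini_tonelli_F (fun p : S * T => (expR (edot (Z p.1) (Y p.2)))%:E)).
    apply/measurable_EFinP/measurableT_comp => //; apply: measurable_edot => i.
      exact: (measurableT_comp (mZ i) measurable_fst).
    exact: (measurableT_comp (mY i) measurable_snd).
  by move=> p; rewrite lee_fin expR_ge0.
have cE : Num.sqrt (s / (s - sigma2)) ^+ n = (c s)^-1 * c (s - sigma2).
  rewrite /c -exprVn -exprMn -sqrtrV ?divr_ge0 ?mulr_ge0 ?pi_ge0 ?ltW //.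
  rewrite -sqrtrM ?invr_ge0 ?divr_ge0 ?mulr_ge0 ?pi_ge0 ?ltW //.
  congr (Num.sqrt _ ^+ n); move: pi (pi_gt0 R) => p p0.
  by field; rewrite !gt_eqF.
have swapgX := swap _ _ s0 mgX.
have swapg := swap _ _ ss0 mg.
rewrite cE (EFinM (c s)^-1) -muleA swapg lee_pdivlMl ?c0 // swapgX.
apply: ge0_le_integral => //; first by
  move=> z _; apply: mule_ge0 => //; apply: integral_ge0 => w _; rewrite lee_fin expR_ge0.
- exact: minner.
- exact: minner.
move=> z _.
(* Pointwise in [z], the noise contributes at most [exp(|z|^2 sigma2 / 2)], which turns the Gaussian
   weight of parameter [s] into that of parameter [s - sigma2]. *)
under eq_integral do rewrite edotDr expRD.
rewrite indep muleCA muleC.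
have -> : expR (- ((s - sigma2) / 2 * edot (Z z) (Z z))) =
    expR (- (s / 2 * edot (Z z) (Z z))) * expR (edot (Z z) (Z z) * sigma2 / 2).
  by rewrite -expRD; congr expR; ring.
apply: lee_wpmul2r.
  by apply: integral_ge0 => w _; rewrite lee_fin expR_ge0.
by rewrite EFinM; apply: lee_wpmul2l; [rewrite lee_fin expR_ge0|exact: subG_mgf].
Qed.
End step.

(** * The variance recursion, Markov's inequality and norm events *)

(** The new summand is [sigma_t^2 / psi_t] and the new prefactor is [psi_t], so they leave
    [sigma_t^2]; positivity of [L] makes [psi_t] invertible. *)
Lemma Psi_recr (R : realType) (L sigma : nat -> R) t : (forall t, 0 < L t) ->
  Psi L sigma t.+1 = L t ^+ 2 * Psi L sigma t + sigma t ^+ 2.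
Proof.
move=> L0; have psiS : psi_shift L t.+1 = L t ^+ 2 * psi_shift L t.
  by rewrite /psi_shift big_ord_recr mulrC.
have psi0 : psi_shift L t.+1 != 0.
  by apply/lt0r_neq0/prodr_gt0 => i _; rewrite exprn_gt0.
by rewrite /Psi big_ord_recr mulrDr mulrCA mulfV // mulr1 psiS -mulrA.
Qed.

Lemma Psi_ge0 (R : realType) (L sigma : nat -> R) t : 0 <= Psi L sigma t.
Proof.
have psi0 k : 0 <= psi_shift L k by apply: prodr_ge0 => i _; rewrite sqr_ge0.
by rewrite mulr_ge0 // sumr_ge0 // => i _; rewrite divr_ge0 // sqr_ge0.
Qed.

Lemma markov_ineq d (T : measurableType d) (R : realType)
    (mu : {measure set T -> \bar R}) (F : T -> \bar R) (A : set T) (c : \bar R) :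
  measurable A -> measurable_fun setT F -> (forall x, 0 <= F x)%E ->
  (forall x, A x -> c <= F x)%E -> (0 <= c)%E -> (c * mu A <= \int[mu]_x F x)%E.
Proof.
move=> mA mF F0 cF c0; rewrite -integral_cst //.
apply: (@le_trans _ _ (\int[mu]_(x in A) F x)%E).
  by apply: ge0_le_integral => //; exact: measurable_funTS.
exact: ge0_subset_integral.
Qed.

Lemma measurable_enorm_gt (R : realType) d (T : measurableType d) n
    (Y : T -> 'rV[R]_n) (r : R) :
  (forall i, measurable_fun setT (fun x => Y x 0 i)) ->
  measurable [set x | r < enorm (Y x)].
Proof.
move=> mY; have mE : measurable_fun setT (fun x => enorm (Y x)).
  exact: (measurableT_comp (continuous_measurable_fun (@sqrt_continuous R))
    (measurable_edot mY mY)).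
have := mE measurableT _ (measurable_itv `]r, +oo[).
by rewrite setTI preimage_itvoy.
Qed.

(** * Measurability of the stochastic trajectory *)

Section trajectory.
Context (R : realType) (n m : nat) (f : 'rV[R]_n -> 'rV[R]_m -> nat -> 'rV[R]_n)
  (x0 : 'rV[R]_n) (dd : nat -> 'rV[R]_m).
Hypothesis f_cont : forall t dv, continuous (fun x => f x dv t).

Lemma measurable_drift d (T : measurableType d) (Y : T -> 'rV[R]_n) dv t :
  (forall i, measurable_fun setT (fun x => Y x 0 i)) ->
  forall i, measurable_fun setT (fun x => f (Y x) dv t 0 i).
Proof.
move=> mY i; have YE x : Y x = \row_j Y x 0 j by apply/rowP => j; rewrite mxE.
under eq_fun do rewrite YE.
apply: (@measurable_continuous_row _ _ _ _ (fun y => f y dv t 0 i)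
  (fun j x => Y x 0 j)) => // y.
apply: (@continuous_comp _ _ _ (fun y => f y dv t) (fun M : 'rV[R]_n => M 0 i)).
  exact: f_cont.
exact: coord_continuous.
Qed.

(** Asking measurability only of the noises before [t] allows [T] to carry the sigma-algebra of the
    past, which expresses that the state at time [t] depends on the past alone. *)
Lemma measurable_stoch_traj d (T : measurableType d) (w : nat -> rvec T R n) t :
  (forall s, (s < t)%N -> rvec_measurable (w s)) ->
  forall i, measurable_fun setT
    (fun x => stoch_traj f x0 dd (fun k => vec_of (w k) x) t 0 i).
Proof.
elim: t => [|t IH] mw i; first exact: measurable_cst.
under eq_fun do rewrite mxE [vec_of _ _ _ _]mxE.
apply: measurable_funD; last exact: mw.
by apply: measurable_drift; apply: IH => s st; apply: mw; exact: ltnW.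
Qed.
End trajectory.

(** * Exponential moment and tail of the error *)

Section error.
Context (R : realType) (n m : nat) (f : 'rV[R]_n -> 'rV[R]_m -> nat -> 'rV[R]_n)
  (x0 : 'rV[R]_n) (dd : nat -> 'rV[R]_m) (L sigma : nat -> R)
  (dsp : measure_display) (Omega : measurableType dsp) (P : probability Omega R)
  (w : nat -> rvec Omega R n).
Hypotheses (f_cont : forall t dv, continuous (fun x => f x dv t))
  (L_pos : forall t, 0 < L t)
  (f_lip : forall t x y dv, enorm (f x dv t - f y dv t) <= L t * enorm (x - y))
  (w_meas : forall t, rvec_measurable (w t))
  (w_indep : mutually_independent P w)
  (sigma_pos : forall t, 0 < sigma t)
  (w_subG : forall t, subG P (w t) (sigma t ^+ 2)).

Let X (t : nat) (om : Omega) := stoch_traj f x0 dd (fun k => vec_of (w k) om) t.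
Let err t om := X t om - det_traj f x0 dd t.

Lemma measurable_err t i : measurable_fun setT (fun om => err t om 0 i).
Proof.
under eq_fun do rewrite mxE; apply: measurable_funD => //.
by apply: measurable_stoch_traj => // s _; exact: w_meas.
Qed.

Lemma drift_noise_indep t (z : 'rV[R]_n) :
  let g om := f (X t om) (dd t) t - f (det_traj f x0 dd t) (dd t) t in
  (\int[P]_om (expR (edot z (g om)) * expR (edot z (vec_of (w t) om)))%:E =
   \int[P]_om (expR (edot z (g om)))%:E *
   \int[P]_om (expR (edot z (vec_of (w t) om)))%:E)%E.
Proof.
move=> g.
(* Here [Omega] carries the sigma-algebra of the past, and for [mV] below the one generated by
   [w t]. *)
have mU : measurable_fun setT
    (fun om : g_sigma_algebraType (past_events w t) => expR (edot z (g om))).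
  apply: measurableT_comp => //; apply: measurable_edot => // i.
  under eq_fun do rewrite mxE; apply: measurable_funD => //.
  apply: measurable_drift => // j.
  apply: measurable_stoch_traj => // s st k _ B mB; rewrite setTI.
  by apply: sub_sigma_algebra; exists s, k, B.
have mV : measurable_fun setT (fun om : g_sigma_algebraType
      [set A | exists i (B : set R), measurable B /\ A = w t i @^-1` B] =>
    expR (edot z (vec_of (w t) om))).
  apply: measurableT_comp => //; apply: measurable_edot => // i.
  move=> _ B mB; rewrite setTI; apply: sub_sigma_algebra; exists i, B.
  by split=> //; apply/seteqP; split=> om /=; rewrite mxE.
apply: ge0_integral_indep => [||om|om|A B mA mB]; rewrite ?expR_ge0 //.
- apply: measurableT_comp => //; apply: measurable_edot => // i.
  under eq_fun do rewrite mxE; apply: measurable_funD => //.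
  apply: measurable_drift => // j.
  by apply: measurable_stoch_traj => // s _; exact: w_meas.
- apply: measurableT_comp => //; apply: measurable_edot => // i.
  by under eq_fun do rewrite mxE; exact: w_meas.
- apply: (past_events_indep (w := w) (t := t)) => //.
    by have := mU measurableT A mA; rewrite setTI.
  by have := mV measurableT B mB; rewrite setTI.
Qed.

(** Induction on [t] with [s] free, since each step changes the parameter. At time 0 the error
    vanishes. *)
Lemma err_mgf t s : Psi L sigma t < s ->
  (\int[P]_om (expR (edot (err t om) (err t om) / (2 * s)))%:E
    <= (Num.sqrt (s / (s - Psi L sigma t)) ^+ n)%:E)%E.
Proof.
elim: t s => [|t IH] s.
  have -> : Psi L sigma 0 = 0 by rewrite /Psi big_ord0 mulr0.
  move=> s0; rewrite subr0 divff ?gt_eqF // sqrtr1 expr1n.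
  rewrite (eq_integral (cst 1%E)) => [|om _].
    by rewrite integral_cst // mul1e probability_le1.
  by rewrite /err subrr edot0l mul0r expR0.
rewrite Psi_recr // => Ps.
have L2 : 0 < L t ^+ 2 by rewrite exprn_gt0.
have LP : 0 <= L t ^+ 2 * Psi L sigma t by rewrite mulr_ge0 ?Psi_ge0 // ltW.
have ss0 : 0 < s - sigma t ^+ 2 by lra.
pose g om := f (X t om) (dd t) t - f (det_traj f x0 dd t) (dd t) t.
have mg i : measurable_fun setT (fun om => g om 0 i).
  under eq_fun do rewrite mxE; apply: measurable_funD => //.
  apply: measurable_drift => // j.
  by apply: measurable_stoch_traj => // k _; exact: w_meas.
have errS om : err t.+1 om = g om + vec_of (w t) om.
  by rewrite /err /g /X /= addrAC.
under eq_integral do rewrite errS.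
have sig_s : 0 <= sigma t ^+ 2 < s by rewrite sqr_ge0 -subr_gt0.
apply: le_trans (subG_gauss_step (w_meas t) mg sig_s (w_subG t) _) _.
  exact: drift_noise_indep.
(* Dividing by [L_t^2] absorbs the Lipschitz factor, and [Psi_t < s'] is the assumption
   [Psi_(t+1) < s] rewritten. *)
pose s' := (s - sigma t ^+ 2) / L t ^+ 2.
have Ps' : Psi L sigma t < s' by rewrite ltr_pdivlMr // mulrC; lra.
have s'0 : 0 < s' by rewrite divr_gt0.
have le_g : (\int[P]_om (expR (edot (g om) (g om) / (2 * (s - sigma t ^+ 2))))%:E <=
    \int[P]_om (expR (edot (err t om) (err t om) / (2 * s')))%:E)%E.
  apply: ge0_le_integral => //.
  - apply/measurable_EFinP/measurableT_comp => //; apply: measurable_funM => //.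
    exact: measurable_edot.
  - apply/measurable_EFinP/measurableT_comp => //; apply: measurable_funM => //.
    by apply: measurable_edot; exact: measurable_err.
  move=> om _; rewrite lee_fin ler_expR.
  have -> : edot (err t om) (err t om) / (2 * s') =
      L t ^+ 2 * edot (err t om) (err t om) / (2 * (s - sigma t ^+ 2)).
    by rewrite /s'; field; rewrite !gt_eqF // L_pos.
  rewrite ler_pM2r ?invr_gt0 ?mulr_gt0 // -!enorm_sqr -exprMn.
  by rewrite ler_sqr ?nnegrE ?mulr_ge0 ?sqrtr_ge0 // ?[0 <= L t]ltW //; exact: f_lip.
apply: (@le_trans _ _ ((Num.sqrt (s / (s - sigma t ^+ 2)) ^+ n)%:E *
    (Num.sqrt (s' / (s' - Psi L sigma t)) ^+ n)%:E)%E).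
  apply: lee_wpmul2l; first by rewrite lee_fin exprn_ge0 // sqrtr_ge0.
  exact: le_trans le_g (IH _ Ps').
rewrite -EFinM lee_fin -exprMn -sqrtrM; last by rewrite divr_ge0; lra.
(* The product telescopes: the numerator of the second factor cancels the denominator of the
   first. *)
have -> // : s / (s - sigma t ^+ 2) * (s' / (s' - Psi L sigma t)) =
  s / (s - (L t ^+ 2 * Psi L sigma t + sigma t ^+ 2)).
rewrite /s'; field; rewrite !gt_eqF //; try exact: L_pos; lra.
Qed.

(** Markov's inequality for [exp(|e|^2 / 2s)] at [s = Psi / theta], where
    [s / (s - Psi) = 1 / (1 - theta)]. Time [t + 1] ensures [Psi > 0], whereas [Psi_0 = 0]. *)
Lemma err_tail t (theta K : R) : 0 < theta < 1 -> 0 <= K ->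
  ((expR (theta * K / 2))%:E *
     P [set om | (Num.sqrt (Psi L sigma t.+1 * K) < enorm (err t.+1 om))%R]
   <= (Num.sqrt (1 - theta)^-1 ^+ n)%:E)%E.
Proof.
move=> /andP[th0 th1] K0.
have Psi0 : 0 < Psi L sigma t.+1.
  rewrite Psi_recr //; apply: ltr_wpDl; last exact: exprn_gt0.
  by rewrite mulr_ge0 ?Psi_ge0 // sqr_ge0.
set p := Psi L sigma t.+1 in Psi0 *.
have pK0 : 0 <= p * K := mulr_ge0 (ltW Psi0) K0.
have sE : p / theta / (p / theta - p) = (1 - theta)^-1.
  by field; rewrite !gt_eqF //; nra.
have ps : p < p / theta by rewrite ltr_pdivlMr // gtr_pMr.
have := @err_mgf t.+1 (p / theta) ps; rewrite -/p sE; apply: le_trans.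
apply: markov_ineq => //.
- by apply: measurable_enorm_gt; exact: measurable_err.
- apply/measurable_EFinP/measurableT_comp => //; apply: measurable_funM => //.
  by apply: measurable_edot; exact: measurable_err.
- move=> om /= h; rewrite lee_fin ler_expR -enorm_sqr.
  have {}h : p * K <= enorm (err t.+1 om) ^+ 2.
    rewrite -[p * K]sqr_sqrtr //.
    by rewrite ler_sqr ?nnegrE ?sqrtr_ge0 // ltW.
  have -> : theta * K / 2 = p * K / (2 * (p / theta)).
    by field; rewrite !gt_eqF.
  by rewrite ler_pM2r // invr_gt0 mulr_gt0 // divr_gt0.
Qed.
End error.

(** * The constants [eps1] and [eps2], and the union bound *)

(** With [theta = (1 - eps)^2], the factor [theta / 2] cancels the common factor [2 / (1 - eps)^2]
    of [eps1] and [eps2]. *)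
Lemma expR_tail_exponent (R : realType) (n : nat) (eps b : R) :
  0 < eps < 1 -> 0 < b ->
  expR ((1 - eps) ^+ 2 * (eps1 eps * n%:R + eps2 eps * ln b) / 2) =
  (1 + 2 / eps) ^+ n * b.
Proof.
move=> /andP[e0 e1] b0.
have A0 : 0 < 1 + 2 / eps by rewrite addr_gt0 // divr_gt0.
have -> : (1 - eps) ^+ 2 * (eps1 eps * n%:R + eps2 eps * ln b) / 2 =
    n%:R * ln (1 + 2 / eps) + ln b.
  by rewrite /eps1 /eps2; field; lra.
by rewrite expRD expRM_natl !lnK ?posrE.
Qed.

Lemma sqrt_inv_le (R : realType) (eps : R) : 0 < eps < 1 ->
  Num.sqrt (1 - (1 - eps) ^+ 2)^-1 <= 1 + 2 / eps.
Proof.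
move=> /andP[e0 e1].
have A0 : 0 < 1 + 2 / eps by rewrite addr_gt0 // divr_gt0.
have -> : 1 + 2 / eps = Num.sqrt ((1 + 2 / eps) ^+ 2).
  by rewrite sqrtr_sqr ger0_norm // ltW.
rewrite ler_sqrt; last by rewrite exprn_ge0 // ltW.
have i1 : 1 < eps^-1 by rewrite invf_gt1.
(* [1 - (1 - eps)^2 = eps (2 - eps) >= eps], and [1 / eps <= (1 + 2 / eps)^2]. *)
apply: (@le_trans _ _ eps^-1); last by nra.
by rewrite lef_pV2 ?posrE; nra.
Qed.
Unset Implicit Arguments.
Set Strict Implicit.

Theorem theorem2 (R : realType) (n m : nat)
    (f : 'rV[R]_n -> 'rV[R]_m -> nat -> 'rV[R]_n)
    (f_smooth : forall t, smooth (fun p : 'rV[R]_n * 'rV[R]_m => f p.1 p.2 t))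
    (L : nat -> R) (L_pos : forall t, 0 < L t)
    (f_lip : forall t (x y : 'rV[R]_n) (dv : 'rV[R]_m),
        enorm (f x dv t - f y dv t) <= L t * enorm (x - y))
    (dsp : measure_display) (Omega : measurableType dsp)
    (P : probability Omega R)
    (w : nat -> rvec Omega R n)
    (w_meas : forall t, rvec_measurable (w t))
    (w_indep : mutually_independent P w)
    (sigma : nat -> R) (sigma_pos : forall t, 0 < sigma t)
    (w_subG : forall t, subG P (w t) (sigma t ^+ 2))
    (X0 : set 'rV[R]_n) (D : set 'rV[R]_m)
    (x0 : 'rV[R]_n) (x0_in : X0 x0)
    (dd : nat -> 'rV[R]_m)
    (T : nat) (T_pos : (0 < T)%N)
    (dd_in : forall t, (t <= T)%N -> D (dd t))
    (delta eps : R) (delta_pos : 0 < delta) (delta_le1 : delta <= 1)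
    (eps_pos : 0 < eps) (eps_lt1 : eps < 1) :
  (P [set om | forall t, (t <= T)%N ->
      (enorm (stoch_traj f x0 dd (fun k => vec_of (w k) om) t
             - det_traj f x0 dd t)
        <= r_delta n L sigma eps delta T t)%R]
    >= (1 - delta)%:E)%E.
Proof.
have f_cont t dv : continuous (fun x => f x dv t).
  (* The empty list of directions gives joint continuity of [f] itself. *)
  have [c _] := f_smooth t [::]; move=> x.
  apply: (@continuous_comp _ _ _ (fun x => (x, dv)) (fun p => f p.1 p.2 t)).
    exact: (cvg_pair (@cvg_id _ (nbhs x)) (cvg_cst dv)).
  exact: c.
have e01 : 0 < eps < 1 by rewrite eps_pos.
pose e t om := stoch_traj f x0 dd (fun k => vec_of (w k) om) t - det_traj f x0 dd t.
have TR : 0 < T%:R :> R by rewrite ltr0n.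
have Td : 0 < T%:R / delta by rewrite divr_gt0.
pose K := eps1 eps * n%:R + eps2 eps * ln (T%:R / delta).
have th0 : 0 < (1 - eps) ^+ 2 by rewrite exprn_gt0 // subr_gt0.
have K0 : 0 <= K.
  have A1 : 1 <= 1 + 2 / eps by rewrite lerDl ltW // divr_gt0.
  (* [delta <= 1 <= T] makes the logarithm in [K] nonnegative. *)
  have Td1 : 1 <= T%:R / delta.
    by rewrite ler_pdivlMr // mul1r (le_trans delta_le1) // ler1n.
  have [l1 l2] := (ln_ge0 A1, ln_ge0 Td1).
  by apply: addr_ge0; apply: mulr_ge0 => //; apply: divr_ge0;
    rewrite ?(ltW th0) //; exact: mulr_ge0.
pose bad t := [set om | Num.sqrt (Psi L sigma t.+1 * K) < enorm (e t.+1 om)].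
have A0 : 0 < 1 + 2 / eps by rewrite addr_gt0 // divr_gt0.
have mbad t : measurable (bad t).
  by apply: measurable_enorm_gt => i; exact: measurable_err.
have Pbad t : (P (bad t) <= (delta / T%:R)%:E)%E.
  have th : 0 < (1 - eps) ^+ 2 < 1 by rewrite th0 /=; nra.
  have := err_tail x0 dd f_cont L_pos f_lip w_meas w_indep sigma_pos w_subG t th K0.
  rewrite expR_tail_exponent // -/(e _) -/(bad t) => h.
  (* The normaliser is at most the power [(1 + 2 / eps)^n] already present on the left; cancelling
     it leaves [delta / T]. *)
  have {}h : (((1 + 2 / eps) ^+ n * (T%:R / delta))%:E * P (bad t) <=
      ((1 + 2 / eps) ^+ n)%:E)%E.
    apply: le_trans h _; rewrite lee_fin lerXn2r ?nnegrE ?sqrtr_ge0 ?(ltW A0) //.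
    exact: sqrt_inv_le.
  have An : 0 < (1 + 2 / eps) ^+ n by rewrite exprn_gt0.
  have -> : delta / T%:R =
      ((1 + 2 / eps) ^+ n * (T%:R / delta))^-1 * (1 + 2 / eps) ^+ n.
    by move: An; set A := _ ^+ n => An; field; rewrite !gt_eqF.
  by rewrite EFinM lee_pdivlMl // mulr_gt0.
(* [bad t] concerns time [t + 1]. The error at time 0 is zero, so exactly [T] events enter the union
   bound. *)
have -> : [set om | forall t, (t <= T)%N -> enorm (e t om) <= r_delta n L sigma eps delta T t]
    = ~` \big[setU/set0]_(t < T) bad t.
  rewrite -bigcup_mkord; apply/seteqP; split=> [om good [t /= tT]|om good [_|t tT]].
  - by rewrite /bad /= ltNge (good t.+1 tT).
  - by rewrite /e subrr /enorm edot0l sqrtr0 sqrtr_ge0.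
  - by rewrite leNgt; apply/negP => lt_r; apply: good; exists t.
have mU : measurable (\big[setU/set0]_(t < T) bad t) by exact: bigsetU_measurable.
rewrite probability_setC // EFinB leeB //.
apply: (le_trans (Boole_inequality P (fun t _ => mbad t))).
apply: (@le_trans _ _ (\sum_(t < T) (delta / T%:R)%:E)%E).
  by apply: lee_sum => t _; exact: Pbad.
by rewrite sumEFin lee_fin sumr_const card_ord -[leLHS]mulr_natr mulfVK // gt_eqF.
Qed.
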